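(* The functional $\tau:M(X,m)\to[-\infty,\infty)$, $\mu\mapsto\tau(\mu)$ ($t$-entropy), is upper semicontinuous on $M(X,m)$ with respect to the *-weak topology.
   Context: Setting: $(X,\mathfrak A)$ is a measurable space with a $\sigma$-finite measure $m$, and $\alpha:X\to X$ is a measurable mapping. The shift operator $Af=f\circ\alpha$ is assumed to be bounded on the real space $L^1(X,m)$; equivalently there is a constant $C$ with $m(\alpha^{-1}(G))\le C\,m(G)$ for all $G\in\mathfrak A$. $L^\infty(X,m)$ is the space of essentially bounded real-valued functions. $M(X,m)$ is the set of all positive normalized linear functionals $\mu$ on $L^\infty(X,m)$ (positive: $\mu(f)\ge0$ for $f\ge0$; normalized: $\mu(1)=1$), equipped with the *-weak topology of the dual space of $L^\infty(X,m)$. A measurable partition of unity on $X$ is a finite set $D=\{g_1,\dots,g_k\}$ of nonnegative functions $g_i\in L^\infty(X,m)$ with $g_1+\dots+g_k\equiv1$ almost everywhere. $t$-entropy: for $\mu\in M(X,m)$, $$\tau(\mu)=\inf_{n\in\mathbb N}\frac{\tau_n(\mu)}n,\qquad \tau_n(\mu)=\inf_D\tau_n(\mu,D),\qquad \tau_n(\mu,D)=\sup_{\|f\|=1}\sum_{g\in D}\mu(g)\ln\frac{\int_X g\,|f\circ\alpha^n|\,dm}{\mu(g)},$$ where the infimum is over all measurable partitions of unity $D$ on $X$ and the supremum over all $f\in L^1(X,m)$ with $\|f\|=1$. If $\mu(g)=0$ the corresponding summand is taken to be $0$ regardless of the integral; if some $g\in D$ has $\int_X g\,dm=0$ and $\mu(g)>0$,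 then $\tau(\mu)=-\infty$. Values lie in $[-\infty,\infty)$, with $\ln0=-\infty$. *)

(* Defs.v *)
From HB Require Import structures.
From mathcomp Require Import all_boot all_order all_algebra finmap.
From mathcomp Require Import all_classical all_reals all_analysis ess_sup_inf.

Set Implicit Arguments.
Unset Strict Implicit.
Unset Printing Implicit Defensive.

Import Order.TTheory GRing.Theory Num.Theory.
Import numFieldNormedType.Exports.

Local Open Scope classical_set_scope.
Local Open Scope ring_scope.

(* Counterpart of the library's [lower_semicontinuous]. *)
Definition upper_semicontinuous (T : topologicalType) (R : numFieldType)
    (f : T -> \bar R) : Prop :=
  forall x a, (f x < a%:E)%E ->
    exists2 V, nbhs x V & forall y, V y -> (f y < a%:E)%E.

(* Elements of [L1] and [Linf] are representatives: functions that agree almost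
   everywhere are not identified. Everything below depends on the classes only
   (for the functionals in [states], see [states_ae_eq]). *)
Notation L1 m := (LfunType m (lexx 1%E)).
Notation Linf m := (LfunType m (leey 1%E)).

Section t_entropy.
Context d (X : measurableType d) (R : realType).
Variable m : {measure set X -> \bar R}.

Lemma Linf_one_subproof : (cst 1 : X -> R) \in Lfun m +oo%E.
Proof.
rewrite inE; apply/andP; split; first by rewrite inE; exact: measurable_cst.
rewrite inE /= /finite_norm unlock; case: ifPn => [m0|_]; last exact: ltry.
have -> : abse \o (EFin \o cst 1) = cst 1%:E :> (X -> \bar R).
  by apply/funext => x /=; rewrite normr1.
by rewrite ess_sup_cst // ltry.
Qed.

Definition Linf_one : Linf m := Lfun_Sub (leey 1%E) Linf_one_subproof.

(* The shift operator [f |-> f \o alpha] is bounded on L1. *)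
Definition shift_bounded (alpha : X -> X) : Prop :=
  exists C : R, forall f : L1 m,
    ('N[m]_1[EFin \o (f \o alpha)] <= C%:E * 'N[m]_1[EFin \o f])%E.

(* The space M(X, m). As a set of elements of the product space
   [{ptws Linf m -> R}], its coercion to a type carries the subset topology, i.e.
   the coarsest one making all the evaluations [mu |-> mu f] continuous: this is
   the weak-star topology. *)
Definition states : set {ptws Linf m -> R} :=
  [set mu | [/\ scalar (mu : Linf m -> R),
    forall f : Linf m, (\forall x \ae m, 0 <= f x) -> 0 <= mu f
    & mu Linf_one = 1]].

Lemma states_ae_eq (mu : states) (f g : Linf m) :
  f = g %[ae m] -> \val mu f = \val mu g.
Proof.
move=> fg; have [lin pos _] := set_valP mu.
have muB (h k : Linf m) : \val mu (h - k) = \val mu h - \val mu k.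
  have -> : h - k = (-1) *: k + h by rewrite scaleN1r addrC.
  by rewrite lin mulN1r addrC.
have le (h k : Linf m) : h = k %[ae m] -> \val mu k <= \val mu h.
  move=> hk; rewrite -subr_ge0 -muB; apply: pos; apply: filterS hk => x /(_ I) e.
  by have -> : (h - k) x = h x - k x by []; rewrite e subrr.
by apply/eqP; rewrite eq_le !le //; apply: filterS fg => x e /e.
Qed.

(* [D] may contain several representatives of one class, i.e. a repeated member
   of the partition. Merging [k] copies of [g] into [k *: g] does not change the
   sum in [tau_D], so this does not affect the infimum [tau_n]. *)
Definition partition_of_unity (D : {fset Linf m}) : Prop :=
  (forall g : Linf m, g \in D -> \forall x \ae m, 0 <= g x) /\
  \forall x \ae m, \sum_(g <- D) g x = 1.

Variable alpha : X -> X.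

Local Open Scope ereal_scope.

(* [lne r%:E = -oo] for [r <= 0]. *)
Definition tau_term (n : nat) (mu : states) (f : L1 m) (g : Linf m) : \bar R :=
  if \val mu g == 0%R then 0 else
  (\val mu g)%:E *
    lne ((\int[m]_x (g x * `|f (iter n alpha x)|)%:E) * (\val mu g)^-1%:E).

Definition tau_D (n : nat) (mu : states) (D : {fset Linf m}) : \bar R :=
  ereal_sup [set \sum_(g <- D) tau_term n mu f g
            | f in [set f : L1 m | 'N[m]_1[EFin \o f] = 1]].

Definition tau_n (n : nat) (mu : states) : \bar R :=
  ereal_inf [set tau_D n mu D | D in partition_of_unity].

Definition t_entropy (mu : states) : \bar R :=
  ereal_inf [set tau_n n mu * (n%:R^-1)%:E | n in [set n | (0 < n)%N]].

End t_entropy.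

Arguments states {d X R} m.
Arguments partition_of_unity {d X R} m D.
Arguments t_entropy {d X R} m alpha mu.

(* Main.v *)
Require Import Defs.
From HB Require Import structures.
From mathcomp Require Import all_boot all_order all_algebra finmap ring lra.
From mathcomp Require Import all_classical all_reals all_analysis.
From mathcomp Require Import measurable_realfun.

(** An infimum of upper semicontinuous functions is upper semicontinuous, and
    [t_entropy] is the infimum of the [tau_D] over all [n] and all partitions
    [D], scaled by [1 / n]. So it is enough to treat [tau_D alpha n _ D] for one
    fixed [n] and one fixed [D] ([tau_D_usc]). This one is a supremum, over all
    [f] of norm 1, so what is required is an estimate that is uniform in [f].

    A single summand is [q * ln (c / q)], where [q = nu g] and [c] is an
    integral that depends on [f] but not on the state. If [nu] is close to [mu]
    in the weak-star topology then [nu g >= s * mu g] for every [g] in [D], where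
    [s < 1] is as close to 1 as desired ([near_states_ge]). Split [nu g] into
    [s * mu g] and a remainder [w >= 0]. The first part contributes essentially
    [s] times the summand of [mu]. The remainders have total mass [1 - s], and
    [w * ln (c / q) <= t * c - w * ln t - w] for every [t > 0], by
    [ln x <= x - 1]. The integrals [c] are bounded by a constant [K] because the
    shift is bounded on L1 ([shifted_integral_le]), and summing over [D] gives

      [tau_D nu <= s * tau_D mu + t * #|D| * K - (1 - s) * ln t]

    ([tau_D_perturb]). With [t] small first and then [s] close enough to 1, the
    right-hand side drops below any real number above [tau_D mu], also when
    [tau_D mu = -oo].
    The same estimate, started from the weight 0 in place of [mu g], bounds
    [tau_D] from above, whence [t_entropy < +oo]. *)

Import Order.TTheory GRing.Theory Num.Theory.
Import numFieldNormedType.Exports.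

Local Open Scope classical_set_scope.
Local Open Scope ring_scope.

(** * Perturbing the weight in a summand [p * ln (c / p)] *)

Section entropy_summand.
Context {R : realType}.

Lemma ln_le_subr1 {x : R} : 0 < x -> ln x <= x - 1.
Proof.
by move=> x0; rewrite -{1}(subrKC 1 x); apply: le_ln1Dx; rewrite ltrBrDl subrr.
Qed.

(** This is [tau_term] with the state and the integral abstracted into a weight
    [p] and a value [c]; the two are convertible. *)
Definition entropy_summand (p : R) (c : \bar R) : \bar R :=
  (if p == 0%R then 0 else p%:E * lne (c * p^-1%:E))%E.

Lemma entropy_summand_fin (p r : R) : 0 < p -> 0 < r ->
  entropy_summand p r%:E = (p * ln (r / p))%:E.
Proof.
move=> p0 r0; rewrite /entropy_summand gt_eqF//.
by rewrite -EFinM lne_EFin ?divr_gt0// -EFinM.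
Qed.

Lemma entropy_summand_lty (p : R) (c : \bar R) : 0 <= p -> (c < +oo)%E ->
  (entropy_summand p c < +oo)%E.
Proof.
rewrite le_eqVlt => /predU1P[<-|p0] cy; rewrite /entropy_summand ?eqxx ?ltry//.
rewrite gt_eqF//; case: c cy => [r _||]//; last first.
  by rewrite gt0_mulNye ?lte_fin ?invr_gt0//= gt0_muleNy.
rewrite -EFinM; have [r0|r0] := leP (r / p) 0; last by rewrite lne_EFin// ltry.
by rewrite le0_lneNy// gt0_muleNy.
Qed.

(** Write [q = s * p + w]. On the mass [s * p], replacing [ln (r / q)] by
    [ln (r / p)] costs [s * p * ln (p / q) <= p - s * p]; on the mass [w], the
    logarithm is linearised at [1 / t], which gives
    [w * (t * r / q - 1 - ln t) <= t * r - w - w * ln t] because [w <= q]. *)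
Lemma mul_ln_le_perturb (s t p q r : R) :
  0 < s -> 0 < t -> 0 < p -> s * p <= q -> 0 < r ->
  q * ln (r / q) <=
    s * (p * ln (r / p)) + (p - q + t * r - (q - s * p) * ln t).
Proof.
move=> s0 t0 p0 spq r0.
have q0 : 0 < q by apply: lt_le_trans spq; exact: mulr_gt0.
have ln_rq : ln (r / q) = ln (r / p) + ln (p / q).
  by rewrite -lnM ?posrE ?divr_gt0// mulrA divfK ?gt_eqF.
have ln_pq : s * p * ln (p / q) <= p - s * p.
  have := ler_wpM2l (ltW (mulr_gt0 s0 p0)) (ln_le_subr1 (divr_gt0 p0 q0)).
  move/le_trans; apply; rewrite mulrBr mulr1 lerB// mulrA.
  rewrite mulrAC -[leRHS]mul1r ler_wpM2r ?(ltW p0)//.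
  by rewrite ler_pdivrMr// mul1r.
have ln_trq : ln t + ln (r / q) <= t * (r / q) - 1.
  rewrite -lnM ?posrE ?divr_gt0// ln_le_subr1//.
  by rewrite mulr_gt0// divr_gt0.
have tail : (q - s * p) * ln (r / q) <= t * r - (q - s * p) - (q - s * p) * ln t.
  have w0 : 0 <= q - s * p by rewrite subr_ge0.
  have := ler_wpM2l w0 ln_trq.
  have : (q - s * p) * (t * (r / q)) <= t * r.
    rewrite mulrCA ler_wpM2l ?(ltW t0)// mulrCA -[leRHS]mulr1.
    rewrite ler_wpM2l ?(ltW r0)// ler_pdivrMr// mul1r gerBl.
    by rewrite mulr_ge0// ltW.
  by lra.
have -> : q * ln (r / q) =
    s * (p * ln (r / p)) + s * p * ln (p / q) + (q - s * p) * ln (r / q).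
  by rewrite ln_rq; ring.
by lra.
Qed.

(** The previous estimate, extended to the degenerate weights and values. The
    error terms are arranged so that in a sum over weights [p], [q] of total mass
    1 the differences [p - q] cancel. Since [q = 0] forces [p = 0], and since a
    summand with [q > 0] and [c <= 0] is [-oo], no loss occurs there. The case
    [p = 0] is a plain upper bound for the summand of weight [q]. *)
Lemma entropy_summand_perturb (s t p q K : R) (c : \bar R) :
  0 < s -> 0 < t -> 0 <= p -> s * p <= q -> 0 <= K -> (c <= K%:E)%E ->
  (entropy_summand q c <=
   s%:E * entropy_summand p c + (p - q + t * K - (q - s * p) * ln t)%:E)%E.
Proof.
move=> s0 t0 p0 spq K0 cK.
have := le_trans (mulr_ge0 (ltW s0) p0) spq.
rewrite le_eqVlt => /predU1P[q0|q0].
  have p_eq0 : p = 0.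
    by apply/eqP; rewrite eq_le p0 andbT -(pmulr_rle0 _ s0) q0.
  rewrite p_eq0 -q0 /entropy_summand eqxx mule0 add0e lee_fin.
  by rewrite mulr0 !subrr add0r mul0r subr0 mulr_ge0// ltW.
case: c cK => [r|//|] cK; last first.
  rewrite {1}/entropy_summand gt_eqF// gt0_mulNye ?lte_fin ?invr_gt0//=.
  by rewrite gt0_muleNy ?leNye.
have [r0|r0] := leP r 0.
  rewrite {1}/entropy_summand gt_eqF// le0_lneNy ?gt0_muleNy ?leNye//.
  by rewrite -EFinM lee_fin mulr_le0_ge0// invr_ge0 ltW.
rewrite lee_fin in cK.
have trK : t * r <= t * K by rewrite ler_wpM2l// ltW.
move: p0; rewrite le_eqVlt => /predU1P[<-|p0].
  rewrite entropy_summand_fin// /entropy_summand eqxx mule0 add0e lee_fin.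
  have : ln (t * (r / q)) <= t * (r / q) - 1.
    by rewrite ln_le_subr1// mulr_gt0// divr_gt0.
  rewrite lnM ?posrE ?divr_gt0// => /(ler_wpM2l (ltW q0)).
  have -> : q * (t * (r / q) - 1) = t * r - q.
    by field; rewrite gt_eqF.
  by lra.
rewrite !entropy_summand_fin// -EFinM -EFinD lee_fin.
have := mul_ln_le_perturb s t p q r s0 t0 p0 spq r0.
by lra.
Qed.

End entropy_summand.

(** * States and partitions of unity *)

Section t_entropy_usc.
Context {d : measure_display} {X : measurableType d} {R : realType}.
Variable m : {measure set X -> \bar R}.

Lemma state_ge0 (mu : states m) (g : Linf m) :
  (\forall x \ae m, 0 <= g x) -> 0 <= \val mu g.
Proof. by have [_ pos _] := set_valP mu; exact: pos. Qed.

Lemma state_sum (mu : states m) (D : seq (Linf m)) :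
  \val mu (\sum_(g <- D) g) = \sum_(g <- D) \val mu g.
Proof.
have [lin _ _] := set_valP mu.
have muD (g h : Linf m) : \val mu (g + h) = \val mu g + \val mu h.
  by rewrite -[g in LHS]scale1r lin mul1r.
have mu0 : \val mu (0 : Linf m) = 0.
  by apply: (addrI (\val mu (0 : Linf m))); rewrite -muD !addr0.
by elim: D => [|g D IH]; rewrite ?big_nil// !big_cons muD IH.
Qed.

Lemma state_partition (mu : states m) (D : {fset Linf m}) :
  partition_of_unity m D -> \sum_(g <- D) \val mu g = 1.
Proof.
move=> [_ D1]; rewrite -state_sum; have [_ _ mu1] := set_valP mu.
apply: etrans mu1; apply: states_ae_eq; apply: filterS D1 => x Dx _ /=.
rewrite -[RHS]Dx; elim: (D : seq _) => [|g s IH]; rewrite ?big_nil// !big_cons.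
by rewrite -IH.
Qed.

Lemma partition_of_unity_le1 (D : {fset Linf m}) (g : Linf m) :
  partition_of_unity m D -> g \in D -> \forall x \ae m, `|g x| <= 1.
Proof.
move=> [D0 D1] gD.
have := filter_bigI (f := fun h : Linf m => [set x | 0 <= h x])
  (F := nbhs (almost_everywhere m)) _ D0.
move=> /(_ _) D0'; apply: filterS2 D0' D1 => x /= Dx0 Dx1.
apply: (@le_trans _ _ (\sum_(h <- D) h x)); last by rewrite Dx1.
rewrite ger0_norm; last exact: Dx0.
rewrite (big_fsetD1 g)//= lerDl big_seq sumr_ge0// => h.
by rewrite in_fsetD1 => /andP[_ hD]; exact: Dx0.
Qed.

Lemma partition_of_unity1 : partition_of_unity m [fset Linf_one m]%fset.
Proof.
split=> [g|]; first by rewrite in_fset1 => /eqP->; apply: nearW => ?; exact: ler01.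
by apply: nearW => x; rewrite big_seq_fset1.
Qed.

Lemma state_eval_continuous (g : Linf m) :
  continuous (fun mu : states m => \val mu g).
Proof.
move=> mu; apply: (@continuous_comp _ _ _ (\val : states m -> _)
  (fun phi : {ptws Linf m -> R} => phi g)); first exact: initial_continuous.
exact: proj_continuous.
Qed.

(** Where [mu g = 0] the lower bound is the positivity of [nu], so weak-star
    continuity is only needed for the finitely many [g] with [mu g > 0], and
    there [s * mu g < mu g]. *)
Lemma near_states_ge (mu : states m) (D : {fset Linf m}) (s : R) :
  s < 1 -> partition_of_unity m D ->
  \forall nu \near mu, forall g, g \in D -> s * \val mu g <= \val nu g.
Proof.
move=> s1 [D0 _].
apply: (filter_bigI
  (f := fun g => [set nu : states m | s * \val mu g <= \val nu g])
  (nbhs_filter mu)) => g gD /=.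
have := state_ge0 mu g (D0 g gD); rewrite le_eqVlt => /predU1P[<-|mug].
  by apply: filterE => nu /=; rewrite mulr0; exact: state_ge0 (D0 g gD).
apply: (state_eval_continuous g mu (fun y => s * \val mu g <= y)).
by apply: lt_le_nbhsr; rewrite gtr_pMl.
Qed.

(** * Integrals of shifted functions *)

Variable alpha : X -> X.
Hypothesis malpha : measurable_fun [set: X] alpha.
Hypothesis balpha : shift_bounded m alpha.

Lemma measurable_iter (n : nat) : measurable_fun setT (iter n alpha).
Proof.
elim: n => [|n IH]; [exact: measurable_id | exact: (measurableT_comp malpha IH)].
Qed.

Lemma shift_bounded_iter (n : nat) : exists2 K : R, 0 <= K &
  forall f : L1 m, ('N[m]_1[EFin \o (f \o iter n alpha)] <=
    K%:E * 'N[m]_1[EFin \o f])%E.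
Proof.
elim: n => [|n [K K0 IH]]; first by exists 1 => // f; rewrite mul1e.
have [C fC] := balpha.
have fC' (f : L1 m) : ('N[m]_1[EFin \o (f \o alpha)] <=
    (`|C|)%:E * 'N[m]_1[EFin \o f])%E.
  by apply: le_trans (fC f) _; rewrite lee_wpmul2r ?Lnorm_ge0// lee_fin ler_norm.
exists (K * `|C|) => [|f]; first exact: mulr_ge0.
have fL : f \o alpha \in Lfun m 1%E.
  rewrite inE; apply/andP; split.
    by rewrite inE/=; apply: measurableT_comp => //; exact: malpha.
  rewrite inE /finite_norm; apply: le_lt_trans (fC' f) _.
  by rewrite -finite_norm_fine -EFinM ltry.
have := IH (Lfun_Sub (lexx 1%E) fL).
move/le_trans; apply; rewrite EFinM -muleA lee_wpmul2l ?lee_fin//.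
exact: fC'.
Qed.

(** The bound is uniform in [f], in [g] and in the partition, because the members
    of a partition of unity are at most 1 almost everywhere. *)
Lemma shifted_integral_le (n : nat) : exists2 K : R, 0 <= K &
  forall (D : {fset Linf m}) (g : Linf m) (f : L1 m),
    partition_of_unity m D -> g \in D -> ('N[m]_1[EFin \o f] = 1)%E ->
    (\int[m]_x (g x * `|f (iter n alpha x)|)%:E <= K%:E)%E.
Proof.
have [K K0 fK] := shift_bounded_iter n; exists K => // D g f Dpart gD f1.
have mf : measurable_fun setT (f \o iter n alpha).
  by apply: measurableT_comp => //; exact: measurable_iter.
have mfn : measurable_fun setT (@Num.norm _ R \o (f \o iter n alpha)).
  exact: measurableT_comp.
have mgf : measurable_fun [set: X] (fun x => (g x * `|f (iter n alpha x)|)%:E).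
  by apply/measurable_EFinP; apply: measurable_funM.
apply: le_trans (lee_abs _) _.
apply: le_trans (le_abse_integral _ measurableT mgf) _.
have := fK f; rewrite f1 mule1 Lnorm1; apply: le_trans.
apply: ae_ge0_le_integral => //.
- exact: measurableT_comp.
- by apply: measurableT_comp => //; apply/measurable_EFinP.
apply: filterS (partition_of_unity_le1 D g Dpart gD) => x g1 _ /=.
by rewrite lee_fin normrM normr_id ler_piMl.
Qed.

(** * Upper semicontinuity *)

Lemma tau_D_lty (n : nat) (mu : states m) (D : {fset Linf m}) :
  partition_of_unity m D -> (tau_D alpha n mu D < +oo)%E.
Proof.
move=> Dpart; have [K K0 cK] := shifted_integral_le n.
suff : (tau_D alpha n mu D <= (\sum_(g <- D) K)%:E)%E.
  by move/le_lt_trans; apply; rewrite ltry.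
apply: ub_ereal_sup => _ [f f1 <-]; rewrite -sumEFin !big_seq.
apply: lee_sum => g gD.
(* The perturbation estimate from weight 0, with s = t = 1. *)
have mug := state_ge0 mu g (Dpart.1 g gD).
have := entropy_summand_perturb 1 1 0 (\val mu g) K _ ltr01 ltr01 (lexx 0).
rewrite mulr0 => /(_ _ mug K0 (cK D g f Dpart gD f1)).
move=> /le_trans; apply.
rewrite {1}/entropy_summand eqxx mule0 add0e lee_fin ln1; lra.
Qed.

(** Summation of the estimates for the single summands: all states have the same
    total mass on a partition of unity, so the errors of the form [p - q] cancel
    and the remainders add up to [1 - s]. *)
Lemma tau_D_perturb (n : nat) : exists2 K : R, 0 <= K &
  forall (D : {fset Linf m}) (mu nu : states m) (s t : R),
    partition_of_unity m D -> 0 < s -> 0 < t ->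
    (forall g, g \in D -> s * \val mu g <= \val nu g) ->
    (tau_D alpha n nu D <= s%:E * tau_D alpha n mu D +
      (t * (\sum_(g <- D) K) - (1 - s) * ln t)%:E)%E.
Proof.
have [K K0 cK] := shifted_integral_le n; exists K => //.
move=> D mu nu s t Dpart s0 t0 mu_nu.
apply: ub_ereal_sup => _ [f f1 <-].
pose c (g : Linf m) := (\int[m]_x (g x * `|f (iter n alpha x)|)%:E)%E.
pose e (g : Linf m) :=
  \val mu g - \val nu g + t * K - (\val nu g - s * \val mu g) * ln t.
have sum_e : \sum_(g <- D) e g = t * (\sum_(g <- D) K) - (1 - s) * ln t.
  rewrite /e sumrB -mulr_suml big_split/= !sumrB -!mulr_sumr.
  by rewrite !(state_partition _ D)// subrr add0r mulr1.
rewrite -sum_e.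
apply: (@le_trans _ _ (\sum_(g <- D)
    (s%:E * tau_term alpha n mu f g + (e g)%:E))%E).
  rewrite !big_seq; apply: lee_sum => g gD.
  by apply: entropy_summand_perturb => //; [exact: state_ge0 (Dpart.1 g gD)
    | exact: mu_nu | exact: cK gD f1].
rewrite big_split/= sumEFin leeD2r//.
have -> : (\sum_(g <- D) s%:E * tau_term alpha n mu f g =
    s%:E * \sum_(g <- D) tau_term alpha n mu f g)%E.
  rewrite !big_seq fin_num_sume_distrr// => g h gD hD.
  apply: ltpinfty_adde_def; rewrite inE; apply: entropy_summand_lty;
    by [exact: state_ge0 (Dpart.1 _ _)
       |apply: le_lt_trans (cK D _ f Dpart _ f1) (ltry _)].
rewrite lee_wpmul2l ?lee_fin ?(ltW s0)//.
by apply: ereal_sup_ubound; exists f.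
Qed.

Lemma tau_D_usc (n : nat) (D : {fset Linf m}) :
  partition_of_unity m D -> upper_semicontinuous (fun mu => tau_D alpha n mu D).
Proof.
move=> Dpart mu a mua.
have [b mub ba] : exists2 b : R, (tau_D alpha n mu D <= b%:E)%E & b < a.
  case: (tau_D alpha n mu D) mua => [b|//|_]; first by rewrite lte_fin; exists b.
  by exists (a - 1); [exact: leNye | rewrite gtrBl].
have [K K0 pert] := tau_D_perturb n.
pose M := \sum_(g <- D) K; have M0 : 0 <= M by exact: sumr_ge0.
(* Half of the gap a - b pays for the term t * M, which fixes t; the other half
   pays for the terms carrying the factor e = 1 - s. *)
pose h := (a - b) / 2; have h0 : 0 < h by rewrite divr_gt0// subr_gt0.
pose t := h / (M + 1); have t0 : 0 < t by rewrite divr_gt0// ltr_wpDl.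
pose B := `|b + ln t| + 1; have B0 : 0 < B by rewrite ltr_wpDl.
pose e := h / (h + B).
have hB0 : 0 < h + B by exact: addr_gt0.
have e0 : 0 < e by exact: divr_gt0.
have e1 : e < 1 by rewrite ltr_pdivrMr// mul1r ltrDl.
have tM : t * M <= h.
  rewrite /t mulrAC ler_pdivrMr ?ltr_wpDl// ler_wpM2l ?(ltW h0)//.
  by rewrite lerDl.
have eB : e * - (b + ln t) < h.
  apply: (@le_lt_trans _ _ (e * B)).
    rewrite ler_wpM2l ?(ltW e0)// -[leLHS]addr0 lerD//.
    by rewrite -normrN ler_norm.
  by rewrite /e mulrAC ltr_pdivrMr// ltr_pM2l// ltrDr.
exists [set nu : states m |
    forall g, g \in D -> (1 - e) * \val mu g <= \val nu g].
  by apply: near_states_ge => //; rewrite ltrBlDr ltrDl.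
move=> nu /(pert D mu nu (1 - e) t Dpart); rewrite subr_gt0 => /(_ e1 t0).
move/le_lt_trans; apply.
apply: (@le_lt_trans _ _ ((1 - e) * b + (t * M - (1 - (1 - e)) * ln t))%:E).
  rewrite [leRHS]EFinD [in leRHS]EFinM leeD2r// lee_wpmul2l//.
  by rewrite lee_fin subr_ge0 ltW.
rewrite lte_fin; have : b + h + h = a by rewrite /h; lra.
by lra.
Qed.

Lemma t_entropy_lty (mu : states m) : (t_entropy m alpha mu < +oo)%E.
Proof.
apply: le_lt_trans (tau_D_lty 1 mu _ partition_of_unity1).
apply: (@le_trans _ _ (tau_n alpha 1 mu * (1%:R^-1)%:E)%E).
  by apply: ereal_inf_lbound; exists 1%N.
rewrite invr1 mule1; apply: ereal_inf_lbound.
by exists [fset Linf_one m]%fset => //; exact: partition_of_unity1.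
Qed.

Lemma t_entropy_usc : upper_semicontinuous (t_entropy m alpha).
Proof.
move=> mu a /ereal_inf_lt[_ [n /= n0 <-]].
have n0' : 0 < n%:R :> R by rewrite ltr0n.
rewrite lte_pdivrMr// -EFinM => /ereal_inf_lt[_ [D Dpart <-]] mua.
have [V Vmu VD] := tau_D_usc n D Dpart mu _ mua.
exists V => // nu /VD nua.
apply: (@le_lt_trans _ _ (tau_n alpha n nu * (n%:R^-1)%:E)%E).
  by apply: ereal_inf_lbound; exists n.
rewrite lte_pdivrMr// -EFinM; apply: le_lt_trans nua.
by apply: ereal_inf_lbound; exists D.
Qed.

End t_entropy_usc.

Theorem proposition7 (d : measure_display) (X : measurableType d) (R : realType)
    (m : {sigma_finite_measure set X -> \bar R}) (alpha : X -> X)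
    (malpha : measurable_fun [set: X] alpha)
    (balpha : shift_bounded m alpha) :
  (forall mu : states m, (t_entropy m alpha mu < +oo)%E) /\
  upper_semicontinuous (t_entropy m alpha).
Proof.
by split=> [mu|]; [exact: t_entropy_lty | exact: t_entropy_usc].
Qed.
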